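(* For every $\varepsilon > 0$ there exists $k_0$ such that for all integers $k \ge k_0$, \[ r_k(\mathcal{M}) < \left( \frac{10 + \sqrt{19}}{9} + \varepsilon \right) k. \]
   Context: A 3-uniform hypergraph is a set of 3-element subsets (triples) of a vertex set. The messy path $\mathcal{M}$ is the 3-uniform hypergraph $\{abc, bcd, def\}$ on six distinct vertices $a,b,c,d,e,f$. For a 3-uniform hypergraph $\mathcal{H}$, the multicolor Ramsey number $r_k(\mathcal{H})$ is the smallest integer $n$ such that every coloring of $\binom{[n]}{3}$ with $k$ colors contains a monochromatic copy of $\mathcal{H}$. *)

(* Defs.v *)
From mathcomp Require Import all_boot.

Set Implicit Arguments.
Unset Strict Implicit.
Unset Printing Implicit Defensive.

Definition triple (V : finType) := {e : {set V} | #|e| == 3}.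

Definition hypergraph3 (V : finType) := {set triple V}.

Definition messy_path : hypergraph3 'I_6 :=
  let a : 'I_6 := inord 0 in let b : 'I_6 := inord 1 in
  let c : 'I_6 := inord 2 in let d : 'I_6 := inord 3 in
  let e : 'I_6 := inord 4 in let f : 'I_6 := inord 5 in
  [set t : triple 'I_6 |
     val t \in [set [set a; b; c]; [set b; c; d]; [set d; e; f]]].

(* Copies are not required to be induced. *)
Definition contains_copy (V W : finType)
    (H : hypergraph3 V) (G : hypergraph3 W) : Prop :=
  exists2 f : V -> W, injective f &
    forall t : triple V, t \in H ->
      exists2 u : triple W, u \in G & val u = f @: val t.

Definition color_class (n k : nat)
    (chi : {ffun triple 'I_n -> 'I_k}) (c : 'I_k) : hypergraph3 'I_n :=
  [set t | chi t == c].

Definition ramsey_property (k : nat) (V : finType) (H : hypergraph3 V)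
    (n : nat) : Prop :=
  forall chi : {ffun triple 'I_n -> 'I_k},
    exists c : 'I_k, contains_copy H (color_class chi c).

(* r is the number r_k(H). It is a relation rather than a function, so that no
   junk value is needed before the existence of such an r is established. *)
Definition is_ramsey_number (k : nat) (V : finType) (H : hypergraph3 V)
    (r : nat) : Prop :=
  ramsey_property k H r /\ forall n : nat, ramsey_property k H n -> r <= n.

(* Main.v *)
Require Import Defs.
From mathcomp Require Import all_boot all_order all_algebra.
From mathcomp Require Import reals.
From mathcomp Require Import zify ring lra.

(** Up to O(n) exceptional edges, a hypergraph without a messy path consists of
    stars with pairwise disjoint leaf sets [L_x] (the leaves of the star with
    centre [x] span its edges) and of edges on the remaining vertices [T] any
    two of which meet in at most one vertex.  Give every vertex a weight
    [0 < y_v <= 1] and write [Y(A)] for the weight of a set.  Counting ordered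
    triples by the product of their weights, one colour contributes at most
    [3 * sum_x y_x Y(L_x)^2 + Y(T)^2 + O(n)], while all colours together
    contribute [Y(V)^3 - O(Y(V)^2)].

    The weights damp the centres of dominating stars: in a colour where a star
    carries more than half of the total weight, its centre gets weight about
    [sqrt (Y(V \ L_x) / Y(L_x))].  This is a fixed point equation for [y].  A
    multiplicative error [s] in [y] changes the quotient by at most [s^2], hence
    the root by at most [s]; a small additive offset turns this into a
    contraction, so that iteration yields an approximate fixed point.  Charging
    the lost weight [1 - y_x] to the responsible colours, every colour pays at
    most [1.593 Y(V)^2], whence [n <= 1.593 k + o(k)], and
    [1.593 < (10 + sqrt 19) / 9]. *)

Set Implicit Arguments.
Unset Strict Implicit.
Unset Printing Implicit Defensive.

(** * Hypergraphs without a messy path *)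

Lemma card_setU_le (T : finType) (A B : {set T}) m n :
  #|A| <= m -> #|B| <= n -> #|A :|: B| <= m + n.
Proof. by move=> hA hB; apply: leq_trans (leq_card_setU A B) (leq_add hA hB). Qed.

Section Structure.
Variables (V : finType) (E : V -> V -> V -> bool).

(* Links consist of ordered pairs: every edge at [v] is counted twice. *)
Definition link (v : V) : {set V * V} := [set p | E v p.1 p.2].
Definition nbr (a b : V) : {set V} := [set c | E a b c].
Definition avoiding (v b : V) : {set V * V} :=
  [set p in link v | (p.1 != b) && (p.2 != b)].
Definition low (v : V) : bool := #|link v| <= 30.
(** The bound 12 is the number of ordered pairs through two vertices that each have codegree at most
    3 with [v]. *)
Definition centre (v : V) : option V :=
  if low v then None else [pick b | #|avoiding v b| <= 12].
Definition heavy_pairs (v : V) : {set V * V} :=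
  [set p in link v | (4 <= #|nbr v p.1|) && (4 <= #|nbr v p.2|)].
(* The truncation at 30 only makes [card_junk] unconditional: [edge_cases] holds
   because it is inactive wherever it matters. *)
Definition junk (v : V) : {set V * V} :=
  let J := if low v then link v
           else if centre v is Some b then avoiding v b else heavy_pairs v in
  if #|J| <= 30 then J else set0.

Hypothesis E12 : forall a b c, E a b c = E b a c.
Hypothesis E23 : forall a b c, E a b c = E a c b.
Hypothesis Euniq : forall a b c, E a b c -> uniq [:: a; b; c].
Hypothesis messy_free : forall a b c d e f,
  uniq [:: a; b; c; d; e; f] -> E a b c -> E b c d -> E d e f -> False.

Lemma E13 a b c : E a b c = E c b a.
Proof. by rewrite E12 E23 E12. Qed.

Lemma Erot a b c : E a b c = E b c a.
Proof. by rewrite E12 E23. Qed.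

Lemma card_junk v : #|junk v| <= 30.
Proof. by rewrite /junk; case: ifP => // _; rewrite cards0. Qed.

Lemma edge_neq a b c : E a b c -> [/\ a <> b, a <> c & b <> c].
Proof.
by move=> /Euniq /=; rewrite !inE negb_or => /andP[/andP[/eqP ? /eqP ?] /andP[/eqP ? _]].
Qed.

(** If [e] and [f] both avoided [a], [b], [c], the three edges would form a messy path. *)
Lemma codegree2_cover a b c d e f : a != d -> E a b c -> E b c d -> E d e f ->
  (e \in [:: a; b; c]) || (f \in [:: a; b; c]).
Proof.
move=> /eqP ad h1 h2 h3; apply/negPn/negP.
rewrite negb_or !inE !negb_or => /andP[/and3P[/eqP ? /eqP ? /eqP ?] /and3P[/eqP ? /eqP ? /eqP ?]].
have [? ? ?] := edge_neq h1; have [? ? ?] := edge_neq h2; have [? ? ?] := edge_neq h3.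
apply: (messy_free _ h1 h2 h3).
by rewrite /= !inE !negb_or; do ![apply/andP; split=> //]; apply/eqP; congruence.
Qed.

(** Among four common neighbours of [b] and [c], one lies outside [{d, e, f}]; it serves as [a] in
    [codegree2_cover]. *)
Lemma codegree4_cover b c d e f : 4 <= #|nbr b c| -> E b c d -> E d e f ->
  (e \in [:: b; c]) || (f \in [:: b; c]).
Proof.
move=> h4 h h'.
have [a] : exists a, a \in nbr b c :\: [set d; e; f].
  apply/set0Pn; rewrite -card_gt0 cardsD subn_gt0.
  apply: leq_trans h4; rewrite ltnS (leq_trans (subset_leq_card (subsetIr _ _))) //.
  by rewrite (leq_trans (leq_card_setU _ _)) // cards1 addn1 ltnS cards2; case: eqP.
rewrite !inE !negb_or => /andP[/andP[/andP[ad ae] af] hbca].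
have := codegree2_cover ad (etrans (Erot a b c) hbca) h h'.
by rewrite !inE [e == a]eq_sym [f == a]eq_sym (negbTE ae) (negbTE af).
Qed.

(** * Sizes of links, uniqueness and transfer of centres *)

Lemma card_link_through v b :
  #|[set p in link v | (p.1 == b) || (p.2 == b)]| = (2 * #|nbr v b|)%N.
Proof.
have -> : [set p in link v | (p.1 == b) || (p.2 == b)] =
  [set (b, x) | x in nbr v b] :|: [set (x, b) | x in nbr v b].
  apply/setP => -[p q]; rewrite !inE /=; apply/idP/idP.
    case/andP => h /orP[] /eqP hb; subst.
      by apply/orP; left; apply/imsetP; exists q => //; rewrite inE.
    by apply/orP; right; apply/imsetP; exists p => //; rewrite inE E23.
  case/orP => /imsetP[x]; rewrite inE => h [-> ->]; rewrite eqxx ?orbT ?h ?andbT //.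
  by rewrite E23 h.
rewrite cardsU !card_imset; last 2 first.
- by move=> x y []; congruence.
- by move=> x y []; congruence.
rewrite (_ : _ :&: _ = set0) ?cards0 ?subn0 ?mul2n ?addnn //.
apply/setP => -[p q]; rewrite !inE; apply/negP => /andP[/imsetP[x hx [-> ->]] /imsetP[y _ [_ xb]]].
by move: hx; rewrite inE => /edge_neq[_ _]; congruence.
Qed.

Lemma link_split v b : #|link v| = (#|avoiding v b| + 2 * #|nbr v b|)%N.
Proof.
rewrite -card_link_through -(cardsID [set p | (p.1 == b) || (p.2 == b)] (link v)) addnC.
congr (_ + _); apply: eq_card => p; rewrite !inE; case: (E _ _ _) => //=.
- by rewrite andbT negb_or.
- by rewrite andbF.
Qed.

Lemma nbrC a b : nbr a b = nbr b a.
Proof. by apply/setP => c; rewrite !inE E12. Qed.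

(** A pair of the link misses [b], misses [b'], or consists of these two vertices. This allows only
    12 + 12 + 2 pairs, so [v] would be low. *)
Lemma avoiding_inj v b b' :
  ~~ low v -> #|avoiding v b| <= 12 -> #|avoiding v b'| <= 12 -> b = b'.
Proof.
move=> hl h h'; apply/eqP; apply: contraR hl => /eqP bb'.
have hs : link v \subset (avoiding v b :|: avoiding v b') :|: [set (b, b'); (b', b)].
  apply/subsetP => -[p q]; rewrite !inE /= !xpair_eqE => ->; rewrite !andTb.
  by case: (p =P b) => ?; case: (q =P b) => ?; case: (p =P b') => ?;
    case: (q =P b') => ? //=; exfalso; congruence.
have hp : #|[set (b, b'); (b', b)]| <= 2 by rewrite cards2; case: eqP.
by apply: leq_trans (subset_leq_card hs) (leq_trans (card_setU_le (card_setU_le h h') hp) _).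
Qed.

Lemma centre_low v p : centre v = Some p -> ~~ low v.
Proof. by rewrite /centre; case: ifP. Qed.

Lemma centre_avoiding v p : centre v = Some p -> #|avoiding v p| <= 12.
Proof. by rewrite /centre; case: ifP => // _; case: pickP => // b hb [<-]. Qed.

Lemma centre_eq v p : ~~ low v -> #|avoiding v p| <= 12 -> centre v = Some p.
Proof.
move=> hl hp; rewrite /centre (negbTE hl); case: pickP => [b hb|/(_ p)]; last by rewrite hp.
by congr Some; apply: avoiding_inj hl hb hp.
Qed.

Lemma centre_codegree v p : centre v = Some p -> 4 <= #|nbr v p|.
Proof.
move=> h; have := centre_low h; have := centre_avoiding h.
by rewrite /low (link_split v p); lia.
Qed.

Lemma low_junk a b c : low a -> E a b c -> (b, c) \in junk a.
Proof. by rewrite /junk => hl h; rewrite hl; move: hl; rewrite /low => ->; rewrite inE. Qed.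

Lemma centre_junk p a b c :
  centre a = Some p -> E a b c -> b != p -> c != p -> (b, c) \in junk a.
Proof.
move=> hp h bp cp; rewrite /junk (negbTE (centre_low hp)) hp.
by rewrite (leq_trans (centre_avoiding hp)) // !inE h bp cp.
Qed.

(** As [v] and [p] have codegree at least 4, every edge at [x] avoiding [p] contains [v]. Writing
    [x] in place of [v] maps the pairs at [x] avoiding [p] injectively to such pairs at [v]. *)
Lemma centre_transfer v p x : centre v = Some p -> E v p x -> ~~ low x -> centre x = Some p.
Proof.
move=> hv h hx; apply: centre_eq hx _; apply: leq_trans (centre_avoiding hv).
pose g (q : V * V) := if q.1 == v then (x, q.2) else (q.1, x).
have cov e f : E x e f -> e != p -> f != p -> e = v \/ f = v.
  move=> hxef /negbTE ep /negbTE fp; have := codegree4_cover (centre_codegree hv) h hxef.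
  by rewrite !inE ep fp !orbF => /orP[] /eqP; [left|right].
have [_ _ /eqP] := edge_neq h; rewrite eq_sym => px.
have gi : {in avoiding x p &, injective g}.
  move=> [e f] [e' f']; rewrite !inE /g /= => /andP[h1 /andP[e1 f1]] /andP[h2 /andP[e2 f2]].
  have [? ? ?] := edge_neq h1; have [? ? ?] := edge_neq h2.
  have := cov _ _ h1 e1 f1; have := cov _ _ h2 e2 f2.
  by case: eqP => ?; case: eqP => ? [?|?] [?|?] ?; congruence.
rewrite -(card_in_imset gi); apply/subset_leq_card/subsetP => q /imsetP[[e f] + ->].
rewrite !inE /g /= => /andP[h1 /andP[e1 f1]]; case: eqP => [ev|ne] /=.
  by rewrite px f1 -ev E12 h1.
have fv : f = v by case: (cov _ _ h1 e1 f1).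
by rewrite px e1 -fv E13 h1.
Qed.

(** * Classification of edges *)

Definition star p x y := (centre x == Some p) && (centre y == Some p).

(** An edge missing the centre [p] of [a] is junk at [a]; if it contains [p], [centre_transfer]
    gives its third vertex the centre [p] too. *)
Lemma centre_case a b c p : centre a = Some p -> E a b c -> ~~ low b -> ~~ low c ->
  [|| (b, c) \in junk a, star b a c | star c a b].
Proof.
move=> hp h lb lc; rewrite /star.
have [bp|bp] := eqVneq b p.
  by subst p; rewrite (centre_transfer hp h lc) hp eqxx !orbT.
have [cp|cp] := eqVneq c p.
  by rewrite E23 in h; subst p; rewrite (centre_transfer hp h lb) hp eqxx !orbT.
by rewrite (centre_junk hp h bp cp).
Qed.

(** Otherwise at most 6 pairs at [d] avoid [c], since by [codegree4_cover] they all pass through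
    [b]; then [c] would be the centre of [d]. *)
Lemma codegree_uncentred b c d : ~~ low d -> centre d = None ->
  4 <= #|nbr b c| -> E b c d -> 4 <= #|nbr d b|.
Proof.
move=> ld cd h4 h; rewrite leqNgt; apply/negP => h3.
suff /(centre_eq ld) : #|avoiding d c| <= 12 by rewrite cd.
have : avoiding d c \subset [set p in link d | (p.1 == b) || (p.2 == b)].
  apply/subsetP => -[e f]; rewrite !inE /= => /andP[h1 /andP[/negbTE e1 /negbTE f1]].
  by rewrite h1; have := codegree4_cover h4 h h1; rewrite !inE e1 f1 !orbF.
by move/subset_leq_card; rewrite card_link_through; lia.
Qed.

(* If [ab] has codegree at least 4, then so have [ac] and [bc], which makes [abc]
   junk; if it has codegree 2 or 3, then [c] would be centred at another common
   neighbour of [a] and [b]. *)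
Lemma uncentred_case a b c : E a b c -> ~~ low a -> ~~ low b -> ~~ low c ->
  centre a = None -> centre b = None -> centre c = None ->
  ((a, b) \in junk c) || (#|nbr a b| <= 1).
Proof.
move=> h la lb lc ca cb cc.
have [h4|h3] := leqP 4 #|nbr a b|.
  have h4a := codegree_uncentred lc cc h4 h.
  have h4b : 4 <= #|nbr c b|.
    by apply: (codegree_uncentred (c := a)) => //; rewrite 1?nbrC // E12.
  (* If [e] is outside [{a, b}], [codegree4_cover] confines the common neighbours of [c] and [e] to
     [{a, b}], too few for a heavy pair. *)
  have hs : heavy_pairs c \subset setX [set a; b] [set a; b].
    have sm e f : E c e f -> 4 <= #|nbr c e| -> e \in [set a; b].
      move=> hcef; apply: contraLR => hn; rewrite -ltnNge.
      have : nbr c e \subset [set a; b].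
        apply/subsetP => y; rewrite inE => hy; have := codegree4_cover h4 h hy.
        by move: hn; rewrite !inE => /negbTE ->.
      by move=> /subset_leq_card /leq_ltn_trans; apply; rewrite cards2; case: eqP.
    apply/subsetP => -[e f]; rewrite inE inE [_ \in setX _ _]inE /= => /andP[h1 /andP[h2 h3]].
    by rewrite (sm e f) // (sm f e) // E23.
  rewrite /junk (negbTE lc) cc (leq_trans (subset_leq_card hs)); last first.
    by rewrite cardsX cards2; case: eqP.
  by rewrite !inE /= h4a h4b Erot h.
rewrite orbC leqNgt; have [h2|//] := boolP (1 < _); exfalso.
have : 0 < #|nbr a b :\ c| by move: h2; rewrite (cardsD1 c (nbr a b)) inE h.
rewrite card_gt0 => /set0Pn[d]; rewrite !inE => /andP[dc hd].
(* By [codegree_uncentred], codegree 4 at [ca] or [cb] would carry over to [ab]. Hence at most 6 + 6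
   pairs at [c] meet [{a, b}], and by [codegree2_cover] all pairs avoiding [d] do. *)
have h3a : #|nbr c a| <= 3.
  rewrite leqNgt; apply/negP => h4.
  have : 4 <= #|nbr b a| by apply: (codegree_uncentred (c := c)) => //; rewrite 1?nbrC // E23.
  by rewrite nbrC; lia.
have h3b : #|nbr c b| <= 3.
  rewrite leqNgt; apply/negP => h4.
  have : 4 <= #|nbr a b|.
    by apply: (codegree_uncentred (c := c)) => //; rewrite 1?nbrC // -Erot.
  by lia.
suff /(centre_eq lc) : #|avoiding c d| <= 12 by rewrite cc.
have : avoiding c d \subset [set p in link c | (p.1 == a) || (p.2 == a)]
                        :|: [set p in link c | (p.1 == b) || (p.2 == b)].
  apply/subsetP => -[e f]; rewrite !inE /= => /andP[h1 /andP[/negbTE e1 /negbTE f1]].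
  have hdab : E d a b by rewrite Erot.
  by rewrite h1; have := codegree2_cover dc hdab h h1; rewrite !inE e1 f1 /= => /orP[] /orP[] ->;
     rewrite ?orbT.
move/subset_leq_card/leq_trans; apply.
by rewrite (@leq_trans (6 + 6)) // card_setU_le // card_link_through (@leq_mul 2 _ 2 3).
Qed.

(** A low vertex makes the edge junk, a centred one leads to [centre_case], and otherwise
    [uncentred_case] applies. *)
Lemma edge_cases a b c : E a b c ->
  [|| [|| (b, c) \in junk a, (a, c) \in junk b | (a, b) \in junk c],
      [|| star a b c, star b a c | star c a b] |
      [&& centre a == None, centre b == None & #|nbr a b| <= 1]].
Proof.
move=> h; have h' : E b a c by rewrite E12.
have h'' : E c a b by rewrite Erot.
have [la|la] := boolP (low a); first by rewrite low_junk.
have [lb|lb] := boolP (low b); first by rewrite (low_junk lb) ?orbT.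
have [lc|lc] := boolP (low c); first by rewrite (low_junk lc) ?orbT.
case ea: (centre a) => [p|]; first by case/or3P: (centre_case ea h lb lc) => ->; rewrite ?orbT.
case eb: (centre b) => [p|].
  case/or3P: (centre_case eb h' la lc) => hh; rewrite ?hh ?orbT //.
  by move: hh; rewrite /star [(_ == _) && _]andbC => ->; rewrite !orbT.
case ec: (centre c) => [p|].
  by case/or3P: (centre_case ec h'' la lb) => hh; rewrite ?hh ?orbT //;
  move: hh; rewrite /star [(_ == _) && _]andbC => ->; rewrite !orbT.
by case/orP: (uncentred_case h la lb lc ea eb ec) => ->; rewrite ?orbT.
Qed.
End Structure.

Import Order.TTheory GRing.Theory Num.Theory.
Local Open Scope ring_scope.

(** * Weighted counting of edges *)

Section Weights.
Variables (R : realFieldType) (V : finType) (y : V -> R).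
Hypothesis y01 : forall v, 0 <= y v <= 1.

Lemma y_ge0 v : 0 <= y v. Proof. by case/andP: (y01 v). Qed.
Lemma y_le1 v : y v <= 1. Proof. by case/andP: (y01 v). Qed.

Definition sum3 (g : V -> V -> V -> R) := \sum_a \sum_b \sum_c g a b c.

Lemma sum3_swap g : sum3 (fun a b c => g b a c) = sum3 g.
Proof. by rewrite /sum3 exchange_big. Qed.

Lemma sum3_rot g : sum3 (fun a b c => g c a b) = sum3 g.
Proof.
rewrite /sum3 [RHS]exchange_big; apply: eq_bigr => a _.
by rewrite exchange_big; apply: eq_bigr.
Qed.

Lemma sum3D g h : sum3 (fun a b c => g a b c + h a b c) = sum3 g + sum3 h.
Proof.
rewrite /sum3 -big_split; apply: eq_bigr => a _; rewrite -big_split; apply: eq_bigr => b _.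
by rewrite -big_split.
Qed.

Lemma ler_sum3 g h : (forall a b c, g a b c <= h a b c) -> sum3 g <= sum3 h.
Proof. by move=> gh; do 3![apply: ler_sum => ? _]. Qed.

Definition wt a b c := y a * y b * y c.

Lemma wt_ge0 a b c : 0 <= wt a b c.
Proof. by rewrite !mulr_ge0 ?y_ge0. Qed.

Lemma wt_le1 a b c : wt a b c <= 1.
Proof. by rewrite !mulr_ile1 ?mulr_ge0 ?y_ge0 ?y_le1. Qed.

Lemma wtC a b c : wt b a c = wt a b c. Proof. by rewrite /wt [y b * y a]mulrC. Qed.
Lemma wt_rot a b c : wt c a b = wt a b c. Proof. by rewrite /wt -mulrA mulrC. Qed.

Lemma sum3_wt : sum3 wt = (\sum_v y v) ^+ 3.
Proof.
rewrite /sum3 /wt exprS expr2 big_distrl /=; apply: eq_bigr => a _.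
rewrite mulrA [X in X * _]big_distrr /= big_distrl /=; apply: eq_bigr => b _.
by rewrite big_distrr.
Qed.

Lemma sum3_diag : sum3 (fun a b c => (a == b)%:R * wt a b c) <= (\sum_v y v) ^+ 2.
Proof.
rewrite /sum3 expr2 big_distrl /=; apply: ler_sum => a _.
rewrite (bigD1 a) //= [X in _ + X]big1 ?addr0; last first.
  by move=> b /negbTE ba; rewrite big1 // => c _; rewrite eq_sym ba mul0r.
rewrite big_distrr /=; apply: ler_sum => c _.
by rewrite eqxx mul1r /wt ler_wpM2r ?y_ge0 // ler_piMr ?y_ge0 ?y_le1.
Qed.

(** Union bound over the three coincidences, each handled by [sum3_diag]: a repeated vertex has
    weight at most 1. *)
Lemma sum3_distinct :
  (\sum_v y v) ^+ 3 - 3 * (\sum_v y v) ^+ 2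
    <= sum3 (fun a b c => (uniq [:: a; b; c])%:R * wt a b c).
Proof.
rewrite lerBlDr.
pose d a b c : R := (a == b)%:R * wt a b c.
have le : sum3 wt <= sum3 (fun a b c => (uniq [:: a; b; c])%:R * wt a b c
      + (d a b c + (d b c a + d c a b))).
  apply: ler_sum3 => a b c; rewrite /d -(wt_rot b c a) (wt_rot a b c) /= !inE negb_or.
  have := wt_ge0 a b c; rewrite [c == a]eq_sym -!mulrDl.
  case: (a == b); case: (b == c); case: (a == c) => /= h; rewrite ler_peMl //; lra.
rewrite !sum3D sum3_wt in le.
have e1 : sum3 (fun a b c => d c a b) = sum3 d by rewrite (sum3_rot d).
have e2 : sum3 (fun a b c => d b c a) = sum3 d by rewrite -(sum3_rot (fun a b c => d b c a)).
rewrite e1 e2 in le; apply: le_trans le _.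
by have hd : sum3 d <= _ := sum3_diag; rewrite lerD2l; lra.
Qed.

(** * Weighted count of one colour class *)

Section Edges.
Variable E : V -> V -> V -> bool.
Hypothesis E12 : forall a b c, E a b c = E b a c.
Hypothesis E23 : forall a b c, E a b c = E a c b.
Hypothesis Euniq : forall a b c, E a b c -> uniq [:: a; b; c].
Hypothesis messy_free : forall a b c d e f,
  uniq [:: a; b; c; d; e; f] -> E a b c -> E b c d -> E d e f -> False.

Local Notation ctr := (centre E).

Lemma sum3_junk :
  sum3 (fun a b c => ((b, c) \in junk E a)%:R * wt a b c) <= 30 * #|V|%:R.
Proof.
apply: (@le_trans _ _ (\sum_(a : V) 30)); last by rewrite sumr_const mulr_natr.
apply: ler_sum => a _; rewrite pair_big /=.
apply: (@le_trans _ _ (\sum_(p in junk E a) 1)).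
  rewrite [leRHS]big_mkcond; apply: ler_sum => -[b c] _ /=.
  by case: ifP => _; rewrite ?mul0r ?mul1r ?wt_le1.
by rewrite sumr_const ler_nat card_junk.
Qed.

Lemma sum3_star : sum3 (fun a b c => (star E a b c)%:R * wt a b c) =
  \sum_x y x * (\sum_(v | ctr v == Some x) y v) ^+ 2.
Proof.
apply: eq_bigr => a _; rewrite expr2 big_distrl /= [X in y a * X]big_mkcond big_distrr /=.
apply: eq_bigr => b _; rewrite /star; case: (ctr b == _) => /=; last first.
  by rewrite mulr0 big1 // => c _; rewrite mul0r.
rewrite mulrA big_distrr [RHS]big_mkcond; apply: eq_bigr => c _ /=.
by case: (ctr c == _); rewrite ?mul1r ?mul0r.
Qed.

Lemma sum3_light :
  sum3 (fun a b c => (E a b c && [&& ctr a == None, ctr b == None & (#|nbr E a b| <= 1)%N])%:R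
                     * wt a b c)
  <= (\sum_(v | ctr v == None) y v) ^+ 2.
Proof.
rewrite expr2 big_distrl /= [leRHS]big_mkcond; apply: ler_sum => a _.
case: (ctr a == None) => /=; last first.
  by rewrite big1 // => b _; rewrite big1 // => c _; rewrite andbF mul0r.
rewrite big_distrr [leRHS]big_mkcond; apply: ler_sum => b _ /=.
case: (ctr b == None) => /=; last by rewrite big1 // => c _; rewrite andbF mul0r.
case: (leqP _ 1) => h; last first.
  by rewrite big1 ?mulr_ge0 ?y_ge0 // => c _; rewrite andbF mul0r.
apply: (@le_trans _ _ (\sum_(c in nbr E a b) y a * y b)).
  rewrite [leRHS]big_mkcond; apply: ler_sum => c _; rewrite inE andbT.
  by case: (E a b c); rewrite ?mul0r // mul1r ler_piMr ?mulr_ge0 ?y_ge0 ?y_le1.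
by rewrite sumr_const -mulr_natr ler_piMr ?mulr_ge0 ?y_ge0 // lern1.
Qed.

(** [edge_cases] bounds the indicator of an edge by seven indicators; junk and stars occur in three
    positions each, whence 90 = 3 * 30 and the factor 3. *)
Lemma sum3_edges : sum3 (fun a b c => (E a b c)%:R * wt a b c) <=
  90 * #|V|%:R + 3 * \sum_x y x * (\sum_(v | ctr v == Some x) y v) ^+ 2
  + (\sum_(v | ctr v == None) y v) ^+ 2.
Proof.
pose j a b c := ((b, c) \in junk E a)%:R * wt a b c.
pose s a b c := (star E a b c)%:R * wt a b c.
pose l a b c := (E a b c && [&& ctr a == None, ctr b == None & (#|nbr E a b| <= 1)%N])%:R
                     * wt a b c.
have le : sum3 (fun a b c => (E a b c)%:R * wt a b c) <= sum3 (fun a b c =>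
   j a b c + (j b a c + (j c a b + (s a b c + (s b a c + (s c a b + l a b c)))))).
  apply: ler_sum3 => a b c; rewrite /j /s /l (wtC a b c) (wt_rot a b c) -!mulrDl.
  rewrite ler_wpM2r ?wt_ge0 //.
  case h: (E a b c); last by rewrite !addr_ge0 ?ler0n.
  have := edge_cases E12 E23 Euniq messy_free h; rewrite andTb.
  by rewrite -!natrD ler_nat => /or3P[/or3P[]|/or3P[]|] -> /=; lia.
rewrite !sum3D in le.
have ej : sum3 (fun a b c => j b a c) = sum3 j := sum3_swap j.
have ej' : sum3 (fun a b c => j c a b) = sum3 j := sum3_rot j.
have es : sum3 (fun a b c => s b a c) = sum3 s := sum3_swap s.
have es' : sum3 (fun a b c => s c a b) = sum3 s := sum3_rot s.
have hj : sum3 j <= _ := sum3_junk; have hs : sum3 s = _ := sum3_star.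
have hl : sum3 l <= _ := sum3_light.
by rewrite ej ej' es es' hs in le; lra.
Qed.
End Edges.
End Weights.

(** * Damped weights *)

Section Damping.
Variables (R : realType) (V : finType).
Implicit Types (y z : V -> R) (A : {set V}).

Definition mass y A : R := \sum_(v in A) y v.
(** Positive, to make [step] contract; small enough that passing from [tau] to [damp] costs at most
    2/1000, the margin in [quintic_lower_bound]. *)
Definition offset : R := 1000^-1.
(** This is [min(1, sqrt(Y(V \ A) / Y(A)))]; for nonnegative weights the test excludes a zero
    denominator. *)
Definition tau y A : R :=
  if mass y A <= mass y (~: A) then 1 else Num.sqrt (mass y (~: A) / mass y A).
Definition damp y A : R := (tau y A + offset) / (1 + offset).

Lemma offset_gt0 : 0 < offset. Proof. by rewrite invr_gt0 ltr0n. Qed.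

Lemma offset1_gt0 : 0 < 1 + offset. Proof. by have := offset_gt0; lra. Qed.

Lemma set_mass_ge0 y A : (forall v, 0 <= y v) -> 0 <= mass y A.
Proof. by move=> y0; apply: sumr_ge0 => v _. Qed.

Lemma tau_ge0 y A : 0 <= tau y A.
Proof. by rewrite /tau; case: ifP => // _; rewrite sqrtr_ge0. Qed.

Lemma tau_le1 y A : (forall v, 0 <= y v) -> tau y A <= 1.
Proof.
move=> y0; rewrite /tau; case: (leP (mass y A)) => // h.
have h0 := le_lt_trans (set_mass_ge0 (~: A) y0) h.
by rewrite -sqrtr1 ler_sqrt // ler_pdivrMr // mul1r ltW.
Qed.

Lemma mass_scale s y z A : (forall v, y v <= s * z v) -> mass y A <= s * mass z A.
Proof. by move=> h; rewrite /mass mulr_sumr; apply: ler_sum. Qed.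

Lemma tau_ratio s y z A : 1 <= s -> (forall v, 0 <= y v) -> (forall v, 0 <= z v) ->
  (forall v, y v <= s * z v) -> (forall v, z v <= s * y v) -> tau y A <= s * tau z A.
Proof.
move=> s1 y0 z0 yz zy; have s0 : 0 <= s by lra.
have := tau_le1 A y0; rewrite /tau.
case: (leP (mass z A)) => hz; first by rewrite mulr1 => /le_trans; apply.
have hz0 := set_mass_ge0 (~: A) z0; have hzA := le_lt_trans hz0 hz.
have zyA := mass_scale A zy; have yzA := mass_scale A yz.
have zyC := mass_scale (~: A) zy; have yzC := mass_scale (~: A) yz.
move=> _; rewrite -[X in _ <= X * _](ger0_norm s0) -sqrtr_sqr -sqrtrM ?sqr_ge0 //.
case: (leP (mass y A)) => hy.
  rewrite -[leLHS]sqrtr1 ler_sqrt ?mulr_ge0 ?sqr_ge0 ?invr_ge0 // ?(ltW hzA) //.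
  rewrite mulrA ler_pdivlMr // mul1r expr2 -mulrA.
  apply: le_trans zyA _; apply: ler_wpM2l => //; exact: le_trans hy yzC.
have hy0 := set_mass_ge0 (~: A) y0; have hyA := le_lt_trans hy0 hy.
rewrite ler_sqrt ?mulr_ge0 ?sqr_ge0 ?invr_ge0 // ?(ltW hzA) //.
rewrite [leRHS]mulrA ler_pdivlMr // mulrAC ler_pdivrMr // expr2.
have := ler_pM hy0 (ltW hzA) yzC zyA; lra.
Qed.

Lemma damp_bounds y A : (forall v, 0 <= y v) -> offset / (1 + offset) <= damp y A <= 1.
Proof.
move=> y0; rewrite /damp ler_pM2r ?invr_gt0 ?offset1_gt0 // lerDr tau_ge0 /=.
by rewrite ler_pdivrMr ?offset1_gt0 // mul1r lerD2r tau_le1.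
Qed.

(** The summand [offset] does not move, and as [tau <= 1] it makes up at least the share
    [offset / (1 + offset)] of [tau + offset]. So the excess [s - 1] shrinks by the factor
    [1 + offset]. *)
Lemma damp_ratio s y z A : 1 <= s -> (forall v, 0 <= y v) -> (forall v, 0 <= z v) ->
  (forall v, y v <= s * z v) -> (forall v, z v <= s * y v) ->
  damp y A <= (1 + (s - 1) / (1 + offset)) * damp z A.
Proof.
move=> s1 y0 z0 yz zy; have h := tau_ratio A s1 y0 z0 yz zy.
have t1 := tau_le1 A z0; have t0 := tau_ge0 z A.
have e0 := offset_gt0; have e1 := offset1_gt0.
rewrite /damp mulrA ler_pM2r ?invr_gt0 //.
have k : (s - 1) * tau z A <= (s - 1) / (1 + offset) * (tau z A + offset).
  rewrite mulrAC ler_pdivlMr // -mulrA ler_wpM2l ?subr_ge0 //.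
  by rewrite mulrDr mulr1 lerD2l ler_piMl // ltW.
lra.
Qed.

(** * Approximate fixed point by iteration *)

Section Step.
Variables (I : finType) (L : I -> V -> {set V}).

(** [L i x] stands for the leaf set of the star with centre [x] in colour [i]. *)
Definition step y : V -> R := fun x => \big[Num.min/1]_(i : I) damp y (L i x).

Lemma step_bounds y x : (forall v, 0 <= y v) -> offset / (1 + offset) <= step y x <= 1.
Proof.
move=> y0; rewrite /step; elim/big_ind: _ => [|a b /andP[a0 a1] /andP[b0 b1]|i _].
- by rewrite lexx andbT ler_pdivrMr ?offset1_gt0 // mul1r lerDr.
- by rewrite le_min a0 b0 ge_min a1.
- exact: damp_bounds.
Qed.

Lemma step_le y x i : step y x <= damp y (L i x).
Proof. by rewrite /step (bigD1 i) //= ge_min lexx. Qed.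

Lemma step_ratio s y z x : 1 <= s -> (forall v, 0 <= y v) -> (forall v, 0 <= z v) ->
  (forall v, y v <= s * z v) -> (forall v, z v <= s * y v) ->
  step y x <= (1 + (s - 1) / (1 + offset)) * step z x.
Proof.
move=> s1 y0 z0 yz zy; set c := 1 + _.
have c1 : 1 <= c by rewrite lerDl divr_ge0 ?subr_ge0 // ltW // offset1_gt0.
rewrite /step; elim/big_ind2: _ => [|a b a' b' h h'|i _].
- by rewrite mulr1.
- rewrite minr_pMr ?(le_trans _ c1) // le_min !ge_min h h' ?orbT //.
- exact: damp_ratio.
Qed.

Definition orbit_step t := iter t step (fun=> 1).

Lemma orbit_step_bounds t v : 0 < orbit_step t v <= 1.
Proof.
elim: t v => [|t IH] v; first by rewrite /= ltr01 lexx.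
have y0 u : 0 <= orbit_step t u by case/andP: (IH u) => /ltW.
have /andP[h ->] := step_bounds v y0; rewrite andbT (lt_le_trans _ h) //.
by rewrite divr_gt0 ?offset_gt0 ?offset1_gt0.
Qed.

(** The first step leaves every weight at least [offset / (1 + offset)], the inverse of
    [1 + offset^-1]; each further step contracts the excess by [step_ratio]. *)
Lemma orbit_step_ratio t : let s := 1 + offset^-1 / (1 + offset) ^+ t in
  forall v, orbit_step t.+1 v <= s * orbit_step t v /\ orbit_step t v <= s * orbit_step t.+1 v.
Proof.
have e0 := offset_gt0; have e1 := offset1_gt0.
elim: t => [|t IH] s v.
  rewrite {}/s expr0 divr1 /= mulr1; set u := step _ v.
  have /andP[h h1] : offset / (1 + offset) <= u <= 1 by apply: step_bounds => ?; rewrite ler01.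
  split; first by rewrite (le_trans h1) // lerDl invr_ge0 ltW.
  rewrite (_ : 1 + offset^-1 = (offset / (1 + offset))^-1); last by field; rewrite !gt_eqF.
  by rewrite ler_pdivlMl ?mulr1 ?divr_gt0.
have -> : s = 1 + ((1 + offset^-1 / (1 + offset) ^+ t) - 1) / (1 + offset).
  by rewrite /s exprSr; field; rewrite ?expf_neq0 ?gt_eqF.
have y0 r u : 0 <= orbit_step r u by case/andP: (orbit_step_bounds r u) => /ltW.
have s1 : 1 <= 1 + offset^-1 / (1 + offset) ^+ t.
  by rewrite lerDl divr_ge0 ?invr_ge0 ?exprn_ge0 // ltW.
have IH1 u := proj1 (IH u); have IH2 u := proj2 (IH u).
split; first exact: (step_ratio v s1 (y0 t.+1) (y0 t) IH1 IH2).
exact: (step_ratio v s1 (y0 t) (y0 t.+1) IH2 IH1).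
Qed.

Lemma approximate_fixpoint d : 0 < d -> exists y, forall v,
  [/\ 0 < y v <= 1, step y v <= (1 + d) * y v & y v <= (1 + d) * step y v].
Proof.
move=> d0; have e0 := offset_gt0; have e1 := offset1_gt0.
(* Bernoulli's inequality turns the linear choice of [t] below into the bound [d] on the excess. *)
have bern t : 1 + t%:R * offset <= (1 + offset) ^+ t.
  elim: t => [|t IH]; first by rewrite mul0r addr0.
  rewrite exprS; apply: le_trans (ler_wpM2l (ltW e1) IH).
  rewrite -natr1; have : 0 <= t%:R * offset * offset by rewrite !mulr_ge0 // ltW.
  lra.
pose t := Num.bound (offset^-1 / d / offset).
have ht : offset^-1 / (1 + offset) ^+ t <= d.
  rewrite ler_pdivrMr ?exprn_gt0 // mulrC -ler_pdivrMr //; apply: le_trans (bern t).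
  have : offset^-1 / d / offset < t%:R by rewrite archi_boundP // !divr_ge0 ?invr_ge0 // ltW.
  rewrite ltr_pdivrMr //; lra.
exists (orbit_step t) => v; have [h1 h2] := orbit_step_ratio t v.
have /andP[p0 p1] := orbit_step_bounds t v; have /andP[q0 q1] := orbit_step_bounds t.+1 v.
split; first by rewrite p0 p1.
- by apply: le_trans h1 _; rewrite ler_wpM2r ?(ltW p0) // lerD2l.
- by apply: le_trans h2 _; rewrite ler_wpM2r ?(ltW q0) // lerD2l.
Qed.
End Step.
End Damping.

(* The quintic is (593/1000 + t) (1 + t^2)^2 - 3 t - 3 t^4, i.e. the slack in
   [damping_inequality] for [g = t]. *)
Lemma quintic_lower_bound (R : realFieldType) (t : R) : 0 <= t -> t <= 1 ->
  2/1000 <= t^+5 - 2407/1000 * t^+4 + 2 * t^+3 + 1186/1000 * t ^+2 - 2 * t + 593/1000.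
Proof.
move=> t0 t1.
have t2 : t ^+ 2 <= 1 by rewrite expr_le1.
have t3 : 0 <= t ^+ 3 by rewrite exprn_ge0.
(* The quintic is smallest near 11/20. Up to a small remainder, absorbed by [h2], [h3], [h4], it is
   the square in [h1] times this cubic. *)
have h : 0 <= t^+3 - 13/10 * t^+2 + 1/4 * t + 187/100 by lra.
have h1 := mulr_ge0 (sqr_ge0 (t - 11/20)) h.
have h2 : 0 <= t^+3 * (1 - t) by rewrite mulr_ge0 // subr_ge0.
have h3 : 0 <= t * (1 - t) by rewrite mulr_ge0 // subr_ge0.
have h4 : 0 <= (t - 1) ^+ 2 * (t + 2) by rewrite mulr_ge0 ?sqr_ge0 //; lra.
lra.
Qed.

(** * Cost of one colour *)

Section Cost.
Variable R : realType.
Local Notation e := (offset R).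

(** This is the cost of a dominating star of mass 1 whose complement has mass [t^2]. For [g = t] it
    is the quintic bound; moreover [g - t <= 1/1000], and [g] has coefficient at most 2. *)
Lemma damping_inequality (t g : R) : 0 <= t <= 1 -> g = (t + e) / (1 + e) ->
  3 * g + 3 * t ^+ 4 + (1 - g) * (1 + t ^+ 2) ^+ 2 <= 1593/1000 * (1 + t ^+ 2) ^+ 2.
Proof.
case/andP => t0 t1 gE.
have q := quintic_lower_bound t0 t1.
have e0 : 0 < 1 + e by apply: offset1_gt0.
have gt : g - t = e * (1 - t) / (1 + e) by rewrite gE; field; rewrite gt_eqF.
have g1 : 0 <= g - t.
  by rewrite gt divr_ge0 ?mulr_ge0 ?subr_ge0 // ltW // ?offset_gt0.
have g2 : g - t <= 1/1000.
  rewrite gt ler_pdivrMr // /offset -[1/1000]/(1 * 1000^-1) mul1r.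
  apply: ler_pM; rewrite ?subr_ge0 //.
  - by rewrite invr_ge0.
  - by have := offset_gt0 R; rewrite /offset; lra.
have t2 : t ^+ 2 <= 1 by rewrite expr_le1.
have h : (g - t) * (3 - (1 + t ^+ 2) ^+ 2) <= 1/1000 * 2.
  have hs := sqr_ge0 t.
  have h1 : 1 <= (1 + t ^+ 2) ^+ 2 by rewrite exprn_ege1 // lerDl.
  have h4 : (1 + t ^+ 2) ^+ 2 <= 4.
    by rewrite (_ : 4 = 2 ^+ 2) ?lerXn2r ?nnegrE -?natrX //; lra.
  apply: le_trans (_ : (g - t) * 2 <= _); last by lra.
  by rewrite ler_wpM2l //; lra.
lra.
Qed.

Variables (V : finType) (y : V -> R) (c : V -> option V).
Hypothesis y0 : forall v, 0 < y v.

Definition branch x : {set V} := [set v | c v == Some x].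
Definition uncentred : {set V} := [set v | c v == None].
Local Notation Y := (\sum_v y v).

Lemma mass_setC A : mass y A + mass y (~: A) = Y.
Proof.
rewrite /mass [RHS](bigID (mem A)) /=; congr (_ + _).
by apply: eq_bigl => v; rewrite inE.
Qed.

Lemma mass_partition : \sum_x mass y (branch x) + mass y uncentred = Y.
Proof.
rewrite -(mass_setC uncentred) addrC; congr (_ + _).
rewrite /mass (exchange_big_dep (mem (~: uncentred))) /=; last first.
  by move=> x v _; rewrite !inE => /eqP ->.
apply: eq_bigr => v; rewrite !inE; case cv: (c v) => [p|//] _.
rewrite (eq_bigl (pred1 p)) ?big_pred1_eq // => x.
by rewrite inE cv (inj_eq Some_inj) eq_sym.
Qed.

Lemma damp_small A : mass y A <= mass y (~: A) -> damp y A = 1.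
Proof. by rewrite /damp /tau => ->; rewrite divff // gt_eqF // offset1_gt0. Qed.

Lemma mass_branch_disjoint x x' : x != x' -> mass y (branch x') <= mass y (~: branch x).
Proof.
move=> xx'; rewrite /mass [leRHS]big_mkcond [leLHS]big_mkcond; apply: ler_sum => v _.
rewrite !inE; case: (c v) => [p|] /=; last by rewrite ltW.
case: eqP => [[->]|_]; last by case: ifP => // _; rewrite ltW.
by rewrite (inj_eq Some_inj) eq_sym xx'.
Qed.

(** The third summand charges the colour for the weight it removes from centres. If no branch
    exceeds half of the weight, nothing is damped and 3/2 suffices; otherwise only the dominating
    branch is damped and [damping_inequality] applies. *)
Lemma colour_cost :
  3 * (\sum_x damp y (branch x) * mass y (branch x) ^+ 2) + mass y uncentred ^+ 2
  + (\sum_x (1 - damp y (branch x))) * Y ^+ 2 <= 1593/1000 * Y ^+ 2.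
Proof.
have ge0 v : 0 <= y v by rewrite ltW.
have m0 A := set_mass_ge0 A ge0.
have [/forallP small|] := boolP [forall x, mass y (branch x) <= mass y (~: branch x)].
  rewrite [X in _ + X * _ <= _]big1 => [|x _]; last by rewrite damp_small // subrr.
  have h : \sum_x damp y (branch x) * mass y (branch x) ^+ 2 <= Y / 2 * \sum_x mass y (branch x).
    rewrite mulr_sumr; apply: ler_sum => x _; rewrite damp_small // mul1r expr2.
    by rewrite ler_wpM2r //; have := mass_setC (branch x); have := small x; lra.
  have p := mass_partition; have Y0 : 0 <= Y by apply: sumr_ge0.
  set S := \sum_x mass y (branch x) in h p; set T := mass y uncentred in p *.
  have T0 : 0 <= T by apply: m0.
  have S0 : 0 <= S by apply: sumr_ge0.
  have h2 : T ^+ 2 <= Y * T by rewrite expr2 ler_wpM2r //; lra.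
  have h3 : Y * S + Y * T = Y ^+ 2 by rewrite -mulrDr p expr2.
  have h4 : 0 <= Y * T by rewrite mulr_ge0.
  have h5 : 0 <= Y * S by rewrite mulr_ge0.
  lra.
rewrite negb_forall => /existsP[x0]; rewrite -ltNge => big.
have other x : x != x0 -> damp y (branch x) = 1.
  move=> xx0; apply: damp_small.
  apply: le_trans (mass_branch_disjoint _) (le_trans (ltW big) (mass_branch_disjoint xx0)).
  by rewrite eq_sym.
rewrite [X in _ + X * _ <= _](bigD1 x0) //= [X in _ + (_ + X) * _ <= _]big1; last first.
  by move=> x /other ->; rewrite subrr.
have p := mass_partition; have pC := mass_setC (branch x0).
rewrite (bigD1 x0) //= in p; rewrite [X in 3 * X](bigD1 x0) //=.
set A := mass y (branch x0) in p pC big *; set B := mass y (~: branch x0) in pC big.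
set S := \sum_(_ | _) mass y _ in p; set T := mass y uncentred in p *.
have T0 : 0 <= T by apply: m0.
have B0 : 0 <= B by apply: m0.
have S0 : 0 <= S by apply: sumr_ge0.
(* The other branches and [uncentred] lie in the complement of mass [B], so together they cost at
   most [3 * B * (S + T) = 3 * B^2]. *)
have hS : \sum_(x | x != x0) damp y (branch x) * mass y (branch x) ^+ 2 <= B * S.
  rewrite mulr_sumr; apply: ler_sum => x xx0; rewrite other // mul1r expr2.
  by rewrite ler_wpM2r // mass_branch_disjoint // eq_sym.
have hT : T ^+ 2 <= B * T by rewrite expr2 ler_wpM2r //; lra.
have A0 : 0 < A by apply: le_lt_trans big.
have Bt : B = tau y (branch x0) ^+ 2 * A.
  rewrite /tau leNgt big /= sqr_sqrtr ?divr_ge0 // ?(ltW A0) //.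
  by rewrite mulfVK // gt_eqF.
have t01 : 0 <= tau y (branch x0) <= 1 by rewrite tau_ge0 tau_le1.
have := damping_inequality t01 erefl; rewrite -/(damp y (branch x0)).
set t := tau _ _ in Bt t01 *; set g := damp _ _ => ineq.
have eY : Y = (1 + t ^+ 2) * A by rewrite -pC Bt; ring.
have eST : S + T = B by lra.
have hB : B * S + B * T = B ^+ 2 by rewrite -mulrDr eST expr2.
have BT0 : 0 <= B * T by rewrite mulr_ge0.
apply: le_trans (_ : 3 * (g * A ^+ 2) + 3 * B ^+ 2 + (1 - g) * Y ^+ 2 <= _); first by lra.
rewrite eY Bt; have := ler_wpM2r (sqr_ge0 A) ineq; lra.
Qed.
End Cost.

(** * Summation over the colours *)

Section Combination.
Variables (R : realType) (V I : finType) (E : I -> V -> V -> V -> bool).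
Hypothesis E12 : forall i a b c, E i a b c = E i b a c.
Hypothesis E23 : forall i a b c, E i a b c = E i a c b.
Hypothesis Ecover : forall a b c, (\sum_i E i a b c = uniq [:: a; b; c])%N.
Hypothesis messy_free : forall i a b c d e f,
  uniq [:: a; b; c; d; e; f] -> E i a b c -> E i b c d -> E i d e f -> False.

Lemma coloured_uniq i a b c : E i a b c -> uniq [:: a; b; c].
Proof. by move=> h; have := Ecover a b c; rewrite (bigD1 i) // h; case: (uniq [:: a; b; c]). Qed.

Lemma one_sub_min_le (f : I -> R) : (forall i, f i <= 1) ->
  1 - \big[Num.min/1]_i f i <= \sum_i (1 - f i).
Proof.
move=> f1; suff [] : 1 - \big[Num.min/1]_i f i <= \sum_i (1 - f i) /\ 0 <= \sum_i (1 - f i) by [].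
apply: (big_rec2 (fun m s => 1 - m <= s /\ 0 <= s)) => [|i m s _ [h s0]].
  by rewrite subrr.
by have := f1 i; case: (leP (f i) m) => hm ?; split; lra.
Qed.

(* The hypotheses say that #|V| / #|I| lies in [1.5945, 1.595]; the lower bound
   exceeds the cost 1.593 per colour, and 1.595 is at most (10 + sqrt 19) / 9. *)
Lemma vertex_count_bound : 3189 * #|I|%:R <= 2000 * #|V|%:R :> R ->
  200 * #|V|%:R <= 319 * #|I|%:R :> R ->
  #|I|%:R <= 2000 * (3 + 180 * 1000 ^+ 2) :> R.
Proof.
set n : R := #|V|%:R; set k : R := #|I|%:R => nl nu.
have n0 : 0 <= n by rewrite ler0n.
have k0 : 0 <= k by rewrite ler0n.
pose L i x := branch (centre (E i)) x.
have [d d0 dE] : exists2 d : R, 0 < d & 4 * d = 1 / 1000 by exists (1 / 1000 / 4); lra.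
have [y hy] := approximate_fixpoint L d0.
have y01 v : 0 <= y v <= 1 by have [/andP[/ltW -> ->]] := hy v.
have y0 v : 0 < y v by have [/andP[]] := hy v.
have ge0 v : 0 <= y v by rewrite ltW.
pose Y := \sum_v y v.
pose Z := \sum_i \sum_x (1 - damp y (L i x)).
have Y0 : 0 <= Y by apply: sumr_ge0.
have damp1 A : damp y A <= 1 by case/andP: (damp_bounds A ge0).
have Z0 : 0 <= Z by do 2![apply: sumr_ge0 => ? _]; rewrite subr_ge0.
(* The weight lost at [x] is, up to [d], that of a minimum over the colours, hence at most the sum
   of the losses they demand. *)
have deficit : n - Y <= Z + d * n.
  have -> : n - Y = \sum_x (1 - y x) by rewrite sumrB sumr_const.
  have -> : Z + d * n = \sum_x (\sum_i (1 - damp y (L i x)) + d).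
    by rewrite big_split sumr_const /Z exchange_big mulr_natr.
  apply: ler_sum => x _; have [_ h _] := hy x.
  have h1 : step L y x <= y x + d.
    apply: le_trans h _; rewrite mulrDl mul1r lerD2l ler_piMr ?(ltW d0) //.
    by case/andP: (y01 x).
  suff : 1 - step L y x <= \sum_i (1 - damp y (L i x)) by lra.
  exact: one_sub_min_le.
have colour i : sum3 (fun a b c => (E i a b c)%:R * wt y a b c) <=
    90 * n + (1 + d) * (1593/1000 - \sum_x (1 - damp y (L i x))) * Y ^+ 2.
  have h := sum3_edges y01 (E12 i) (E23 i) (@coloured_uniq i) (@messy_free i).
  have h' : 3 * (\sum_x damp y (L i x) * mass y (L i x) ^+ 2)
      + mass y (uncentred (centre (E i))) ^+ 2
      + (\sum_x (1 - damp y (L i x))) * Y ^+ 2 <= 1593/1000 * Y ^+ 2.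
    exact: colour_cost.
  have mE x : \sum_(v | centre (E i) v == Some x) y v = mass y (L i x).
    by apply: eq_bigl => v; rewrite inE.
  have uE : \sum_(v | centre (E i) v == None) y v = mass y (uncentred (centre (E i))).
    by apply: eq_bigl => v; rewrite inE.
  rewrite uE in h; set T := mass y _ in h h'.
  have hs : \sum_x y x * (\sum_(v | centre (E i) v == Some x) y v) ^+ 2
     <= (1 + d) * \sum_x damp y (L i x) * mass y (L i x) ^+ 2.
    rewrite mulr_sumr; apply: ler_sum => x _; rewrite mE mulrA ler_wpM2r ?sqr_ge0 //.
    have [_ _ h1] := hy x; apply: le_trans h1 _.
    by rewrite ler_wpM2l ?step_le // addr_ge0 // ltW.
  have T0 : 0 <= d * T ^+ 2 by rewrite mulr_ge0 ?sqr_ge0 // ltW.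
  move: h' hs h; rewrite -/n.
  set S := \sum_x damp _ _ * _; set S' := \sum_x y x * _; set z := \sum_x (1 - _).
  move=> h' hs h; apply: le_trans h _.
  have : (1 + d) * (3 * S + T ^+ 2 + z * Y ^+ 2) <= (1 + d) * (1593 / 1000 * Y ^+ 2).
    by rewrite ler_wpM2l // addr_ge0 // ltW.
  by lra.
have total : Y ^+ 3 - 3 * Y ^+ 2 <= 90 * n * k
    + (1 + d) * (1593/1000 * k - Z) * Y ^+ 2.
  have h := sum3_distinct y01; apply: le_trans h _.
  have -> : sum3 (fun a b c => (uniq [:: a; b; c])%:R * wt y a b c) =
      \sum_i sum3 (fun a b c => (E i a b c)%:R * wt y a b c).
    rewrite /sum3 [RHS]exchange_big; apply: eq_bigr => a _.
    rewrite [RHS]exchange_big; apply: eq_bigr => b _.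
    rewrite [RHS]exchange_big; apply: eq_bigr => c _; rewrite -mulr_suml; congr (_ * _).
    by rewrite -Ecover natr_sum.
  apply: le_trans (ler_sum _ (fun i _ => colour i)) _.
  rewrite big_split sumr_const /= -mulr_suml -mulr_sumr sumrB sumr_const -/Z.
  by rewrite -[(90 * n) *+ _]mulr_natr -[(1593 / 1000) *+ _]mulr_natr.
have dn : 4 * (d * n) = n / 1000 by rewrite mulrA dE; lra.
have [V0|/card_gt0P[v0 _]] := posnP #|V|.
  have n00 : n = 0 by rewrite /n V0.
  have C0 : 0 <= 180 * 1000 ^+ 2 :> R by rewrite mulr_ge0 ?exprn_ge0 ?ler0n.
  by move: (180 * _) C0 nl => C C0; rewrite n00 => nl; clear -C0 nl k0; lra.
have Ypos : 0 < Y by rewrite /Y (bigD1 v0) //= ltr_pwDl ?y0 // sumr_ge0.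
have Z_le : Z <= 1593/1000 * k.
  have -> : 1593/1000 * k = \sum_(i : I) (1593/1000) by rewrite sumr_const mulr_natr.
  apply: ler_sum => i _.
  rewrite -(@ler_pM2r _ (Y ^+ 2)) ?exprn_gt0 //; apply: le_trans (colour_cost (centre (E i)) y0).
  rewrite lerDr addr_ge0 ?sqr_ge0 // mulr_ge0 // sumr_ge0 // => x _.
  by rewrite mulr_ge0 ?sqr_ge0 //; case/andP: (damp_bounds (L i x) ge0) => /(le_trans _) -> //;
     rewrite divr_ge0 ?ltW ?offset_gt0 ?offset1_gt0.
(* Here [Y >= n - Z - d * n], where [n - Z >= 0.0015 k] and [d * n < 0.0004 k]. Thus the error
   [90 * n * k] is of order [Y^2]. *)
have kY : k <= 1000 * Y by clear -deficit Z_le dn nl nu n0 k0; lra.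
have kY2 : k ^+ 2 <= 1000 ^+ 2 * Y ^+ 2.
  by rewrite -exprMn ler_pXn2r ?nnegrE // mulr_ge0.
have nk : n * k <= 2 * k ^+ 2 by rewrite expr2 mulrA ler_wpM2r //; clear -nu k0; lra.
have : 90 * n * k <= 180 * 1000 ^+ 2 * Y ^+ 2.
  rewrite -mulrA -[180 * _ * _]mulrA; clear -nk kY2; move: (1000 ^+ 2 * _) kY2 => C kY2; lra.
move: (180 * 1000 ^+ 2) => C nkY.
(* Against [deficit] the term [Z] cancels. Of the gap 0.0015 k the two errors [d * n] and
   [1.593 * d * k] take less than 0.0004 k each, leaving more than k/2000. *)
suff : Y <= 3 + C + (1 + d) * (1593/1000 * k - Z).
  have dZ : 0 <= d * Z by rewrite mulr_ge0 // ltW.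
  have dk : 4 * (d * k) = k / 1000 by rewrite mulrA dE; lra.
  by clear -deficit Z_le dn nl nu n0 k0 dZ dk; lra.
rewrite -(@ler_pM2r _ (Y ^+ 2)) ?exprn_gt0 // -exprS; clear -total nkY; lra.
Qed.
End Combination.

(** * Colourings as families of edge predicates *)

Section Colouring.
Variables (n k : nat) (chi : {ffun triple 'I_n -> 'I_k}).
Local Notation V := 'I_n.

(** [insub] fails unless the set has three elements, so degenerate triples are edges of no
    colour. *)
Definition edge (i : 'I_k) (a b c : V) : bool :=
  if insub [set a; b; c] is Some t then chi t == i else false.

Lemma edge12 i a b c : edge i a b c = edge i b a c.
Proof. by rewrite /edge [[set a; b]]setUC. Qed.

Lemma edge23 i a b c : edge i a b c = edge i a c b.
Proof. by rewrite /edge setUAC. Qed.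

Lemma card_set3 (a b c : V) : (#|[set a; b; c]| == 3) = uniq [:: a; b; c].
Proof.
rewrite -setUA cardsU1 cards2 !inE negb_or /= !inE negb_or.
by case: (a == b); case: (a == c); case: (b == c).
Qed.

Lemma edge_cover a b c : (\sum_i edge i a b c = uniq [:: a; b; c])%N.
Proof.
rewrite /edge -card_set3; case: insubP => [t -> _|/negbTE ->]; last by rewrite big1.
by rewrite (bigD1 (chi t)) //= eqxx big1 // => i /negbTE; rewrite eq_sym => ->.
Qed.

Lemma edgeP i a b c :
  reflect (exists2 t : triple V, val t = [set a; b; c] & chi t = i) (edge i a b c).
Proof.
rewrite /edge; case: insubP => [t h e|h].
  apply: (iffP eqP) => [<-|[t' e' <-]]; first by exists t.
  by congr (chi _); apply: val_inj; rewrite e e'.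
by constructor=> -[t e _]; move: h; rewrite -e (valP t).
Qed.

Lemma copy_of_edges i a b c d e f : uniq [:: a; b; c; d; e; f] ->
  edge i a b c -> edge i b c d -> edge i d e f ->
  contains_copy messy_path (color_class chi i).
Proof.
move=> un h1 h2 h3.
pose g (j : 'I_6) : V := nth a [:: a; b; c; d; e; f] j.
exists g.
  move=> j j' /eqP.
  by rewrite (@nth_uniq _ a [:: a; b; c; d; e; f] j j' (ltn_ord j) (ltn_ord j') un) => /eqP/val_inj.
have gE m : (m < 6)%N -> g (inord m) = nth a [:: a; b; c; d; e; f] m.
  by move=> hm; rewrite /g inordK.
have im x y z : g @: [set x; y; z] = [set g x; g y; g z].
  by rewrite !imsetU !imset_set1.
move=> t; rewrite !inE -orbA => /or3P[] /eqP ->; rewrite im !gE //=.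
- by case/edgeP: h1 => u eu hu; exists u; rewrite ?inE ?hu.
- by case/edgeP: h2 => u eu hu; exists u; rewrite ?inE ?hu.
- by case/edgeP: h3 => u eu hu; exists u; rewrite ?inE ?hu.
Qed.
End Colouring.

(** * Bound on the Ramsey number *)

Lemma ramsey_property_messy_path (R : realType) (n k : nat) :
  3189 * k%:R <= 2000 * n%:R :> R -> 200 * n%:R <= 319 * k%:R :> R ->
  2000 * (3 + 180 * 1000 ^+ 2) < k%:R :> R -> ramsey_property k messy_path n.
Proof.
move=> lo up kbig chi.
have [[i hi]|none] := boolp.pselect (exists c, contains_copy messy_path (color_class chi c)).
  by exists i.
exfalso; move: kbig; apply/negP; rewrite -leNgt.
have := @vertex_count_bound R 'I_n 'I_k (edge chi) (edge12 chi) (edge23 chi) (edge_cover chi).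
rewrite !card_ord; apply=> // i a b c d e f un h1 h2 h3.
by apply: none; exists i; apply: copy_of_edges un h1 h2 h3.
Qed.

(** Classical logic makes the property boolean, so that a least such number can be taken. *)
Lemma ramsey_number_exists k (V : finType) (H : hypergraph3 V) n : ramsey_property k H n ->
  exists2 r : nat, is_ramsey_number k H r & (r <= n)%N.
Proof.
move=> hn; have ex : exists m, boolp.asbool (ramsey_property k H m).
  by exists n; apply/boolp.asboolP.
case: (ex_minnP ex) => r /boolp.asboolP hr rmin; exists r; last by apply: rmin; apply/boolp.asboolP.
by split=> // m hm; apply: rmin; apply/boolp.asboolP.
Qed.

Theorem theorem2 (R : realType) (eps : R) (heps : 0 < eps) :
  exists k0 : nat, forall k : nat, (k0 <= k)%N ->
    exists r : nat, is_ramsey_number k messy_path r /\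
      r%:R < ((10 + Num.sqrt 19) / 9 + eps) * k%:R.
Proof.
pose C : R := 2000 * (3 + 180 * 1000 ^+ 2).
have C_ge : 2000 <= C.
  by rewrite ler_peMr // (le_trans (ler1n R 3)) // lerDl mulr_ge0 ?exprn_ge0 ?ler0n.
exists (Num.bound C) => k hk.
have kC : C < k%:R.
  apply: lt_le_trans (archi_boundP _) _; last by rewrite ler_nat.
  by apply: le_trans C_ge.
(* The number of vertices is the floor of 1.595 k. Rounding loses less than 1, which the gap between
   3189/2000 and 3190/2000 covers once [k >= 2000]. *)
have up : (200 * ((319 * k) %/ 200) <= 319 * k)%N by rewrite mulnC leq_divM.
have lo : (319 * k < 200 * ((319 * k) %/ 200) + 200)%N by rewrite -mulnSr [ltnRHS]mulnC ltn_ceil.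
set n := (_ %/ 200)%N in up lo.
have upR : 200 * n%:R <= 319 * k%:R :> R by rewrite -!natrM ler_nat.
have loR : 319 * k%:R < 200 * n%:R + 200 :> R by rewrite -!natrM -natrD ltr_nat.
have hr : ramsey_property k messy_path n.
  by apply: (@ramsey_property_messy_path R) => //; clear -kC C_ge loR; lra.
have [r rR rn] := ramsey_number_exists hr; exists r; split=> //.
have rnR : r%:R <= n%:R :> R by rewrite ler_nat.
(* 319/200 = (10 + 871/200) / 9 *)
have s19 : 871/200 <= Num.sqrt 19 :> R.
  rewrite -[leLHS]ger0_norm ?divr_ge0 // -sqrtr_sqr ler_sqrt //; lra.
have k0 : 0 < k%:R :> R by clear -kC C_ge; lra.
have ek : 0 < eps * k%:R by rewrite mulr_gt0.
have sk := ler_wpM2r (ltW k0) s19.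
clear -upR rnR sk ek k0; lra.
Qed.
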